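(* Let $P$ be a finite set with $|P| = n \leq 8$ and let $\mathcal{S}$ be a set of $3$-element subsets of $P$. If the arrangement $(P,\mathcal{S})$ has a realization in $\mathbb{R}^2$, then it also has a rational realization, i.e. a realization in which every point has both coordinates in $\mathbb{Q}$. (Equivalently: any arrangement of $n\leq 8$ points is either not realizable with real coordinates or also has a rational realization.)
   Context: An arrangement of $n$ points is a pair $(P,\mathcal{S})$, where $P$ is a set of $n$ points (abstract labels) and $\mathcal{S}=\{S_1,\ldots,S_k\}$ is a (possibly empty) set of $3$-element subsets of $P$. A realization (with real coordinates) of $(P,\mathcal{S})$ is an injective map $f: P\to\mathbb{R}^2$ (so distinct elements of $P$ go to distinct points of the Euclidean plane) such that precisely the triples listed in $\mathcal{S}$ are collinear: for every $3$-element subset $\{p,q,r\}\subseteq P$, the points $f(p),f(q),f(r)$ lie on a common line if and only if $\{p,q,r\}\in\mathcal{S}$. (Four or more points on a common line are allowed; then all $3$-element subsets of them belong to $\mathcal{S}$.) A realization $f$ is rational if $f(P)\subseteq\mathbb{Q}^2$. *)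

(* Defs.v *)
From mathcomp Require Import all_boot all_order all_algebra.
From mathcomp Require Import reals.

Set Implicit Arguments.
Unset Strict Implicit.
Unset Printing Implicit Defensive.

Import Order.TTheory GRing.Theory Num.Theory.
Local Open Scope ring_scope.

Definition arrangement (P : finType) (S : {set {set P}}) : Prop :=
  forall s : {set P}, s \in S -> #|s| = 3%N.

(* {u | on_line a b c u} is a line only when (a, b) != (0, 0). *)
Definition on_line (R : realType) (a b c : R) (u : R * R) : Prop :=
  a * u.1 + b * u.2 = c.

Definition collinear (R : realType) (P : finType) (f : P -> R * R)
    (s : {set P}) : Prop :=
  exists a b c : R,
    (a, b) != (0, 0) /\ forall p : P, p \in s -> on_line a b c (f p).

Definition realization (R : realType) (P : finType) (S : {set {set P}})
    (f : P -> R * R) : Prop :=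
  injective f /\
  forall s : {set P}, #|s| = 3%N -> (collinear f s <-> s \in S).

Definition rational_coords (R : realType) (P : finType) (f : P -> R * R) : Prop :=
  forall p : P, exists x y : rat, f p = (ratr x, ratr y).

(* Main.v *)
Require Import Defs.
From mathcomp Require Import all_boot all_order all_algebra.
From mathcomp Require Import reals.
From mathcomp Require Import boolp filter topology normedtype sequences.
From mathcomp Require Import ring lra.

Set Implicit Arguments.
Unset Strict Implicit.
Unset Printing Implicit Defensive.

Import Order.TTheory GRing.Theory Num.Theory.
Local Open Scope ring_scope.

(** The realization is perturbed into a rational one.  Non-collinearity is an
open condition, so it is enough to find rational point sets arbitrarily close
to the given one in which every collinear triple stays collinear
([approximable], [approximable_realization]).

Such approximations are built one point at a time ([approximable_add_point]).
Call a line rich if it carries at least three of the points under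
consideration.  Suppose that [p] lies on at most two rich lines, and that the
other points have been approximated.  If there is no rich line through [p], any
nearby rational point will do; if there is one, so will a nearby point of the
approximated line with a rational parameter; if there are two, they cross
transversally, and the crossing point of the two approximated lines is rational
and tends to [p].  The construction can only get stuck on a nonempty set of
points each of which lies on at least three rich lines, and [pencils_empty]
shows that no set of at most 8 points of a real plane has this property:

- Three rich lines through [p] carry 7 points, so at most one point is missed.
If the set has 7 points, or if some line carries four of its points, there are
a line through three of the points and four points off it which the points of
that line split into pairs; this makes the line contain the three diagonal
points of a complete quadrangle, as in the Fano plane, which is impossible in
characteristic 0 ([complete_quadrangle], [no_line_beside_quadrangle],
[no_four_collinear]).

- Otherwise there are 8 points and all rich lines carry exactly three of them.
Every point is then joined by rich lines to all but one of the other points, and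
this determines the incidences: they are those of the Moebius-Kantor
configuration ([no_frame]).  A realization of this configuration produces
[X != 0] and [Y] with [X ^+ 2 + X * Y + Y ^+ 2 = 0], which is impossible in an
ordered field ([moebius_kantor]). *)

(** * Collinearity of three points in coordinates *)

(** Twice the signed area of the triangle [u v w]. *)
Definition wedge (F : realFieldType) (u v w : F * F) : F :=
  (v.1 - u.1) * (w.2 - u.2) - (v.2 - u.2) * (w.1 - u.1).

Definition interp (F : realFieldType) (t : F) (u v : F * F) : F * F :=
  (u.1 + t * (v.1 - u.1), u.2 + t * (v.2 - u.2)).

Lemma wedge_rot (F : realFieldType) (u v w : F * F) : wedge u v w = wedge v w u.
Proof. rewrite /wedge; ring. Qed.

Lemma wedge_swap (F : realFieldType) (u v w : F * F) :
  wedge u v w = - wedge v u w.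
Proof. rewrite /wedge; ring. Qed.

Lemma interp0 (F : realFieldType) (u v : F * F) : interp 0 u v = u.
Proof. by rewrite /interp !mul0r !addr0; case: u. Qed.

Lemma interp1 (F : realFieldType) (u v : F * F) : interp 1 u v = v.
Proof. by rewrite /interp !mul1r !subrKC; case: v. Qed.

Lemma wedge_neq0 (F : realFieldType) (u v w : F * F) :
  wedge u v w != 0 -> [/\ u != v, u != w & v != w].
Proof.
by move=> D; split; apply: contra D => /eqP ->; rewrite /wedge; apply/eqP; ring.
Qed.

Lemma wedge_interp (F : realFieldType) (t : F) (u v : F * F) :
  wedge u v (interp t u v) = 0.
Proof. rewrite /wedge /interp /=; ring. Qed.

Lemma wedge0_interp (F : realFieldType) (u v w : F * F) :
  u != v -> wedge u v w = 0 -> exists t, w = interp t u v.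
Proof.
case: u v w => [u1 u2] [v1 v2] [w1 w2]; rewrite /wedge /interp /= => uv col.
have [d1 | d1] := eqVneq (v1 - u1) 0.
  have d2 : v2 - u2 != 0.
    apply: contra uv => /eqP d2; apply/eqP.
    by rewrite -(subrK u1 v1) -(subrK u2 v2) d1 d2 !add0r.
  exists ((w2 - u2) / (v2 - u2)); rewrite divfK // d1 mulr0 addr0.
  move: col; rewrite d1 mul0r sub0r => /eqP.
  rewrite oppr_eq0 mulf_eq0 (negPf d2) /= => /eqP e; congr (_, _); lra.
exists ((w1 - u1) / (v1 - u1)); rewrite divfK //; congr (_, _); first by ring.
apply: (mulfI d1); rewrite mulrDr mulrA mulrCA mulfV // mulr1; lra.
Qed.

Lemma wedge0_trans (F : realFieldType) (u v x y z : F * F) :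
  u != v -> wedge u v x = 0 -> wedge u v y = 0 -> wedge u v z = 0 ->
  wedge x y z = 0.
Proof.
move=> uv /(wedge0_interp uv)[r ->] /(wedge0_interp uv)[s ->].
move=> /(wedge0_interp uv)[t ->]; rewrite /wedge /interp /=; ring.
Qed.

(** The diagonal points of the complete quadrangle [b b' c c'] are not
collinear.  With respect to the affine frame [p b c], the four collinearities
and that of [p a a'] become polynomial equations in the parameters of [b'],
[c'], [a] and [a'], and a combination of these equations is twice a product of
nonzero factors. *)
Lemma complete_quadrangle (F : realFieldType) (p b b' c c' a a' : F * F) :
  wedge p b c != 0 -> p != b' -> b != a -> b != a' -> c != c' ->
  wedge p b b' = 0 -> wedge p c c' = 0 ->
  wedge b c a = 0 -> wedge b' c' a = 0 ->
  wedge b c' a' = 0 -> wedge b' c a' = 0 -> b != c' ->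
  wedge p a a' != 0.
Proof.
move=> D pb' ba ba' cc' pbb pcc bca bca' bc'a' b'ca' bc'.
apply/negP => /eqP paa.
have [pb pc bc] := wedge_neq0 D.
have [t tE] := wedge0_interp pb pbb.
have [s sE] := wedge0_interp pc pcc.
have [k kE] := wedge0_interp bc bca.
have [n nE] := wedge0_interp bc' bc'a'.
have t0 : t != 0 by apply: contra pb' => /eqP t0; rewrite tE t0 interp0.
have k0 : k != 0 by apply: contra ba => /eqP k0; rewrite kE k0 interp0.
have n0 : n != 0 by apply: contra ba' => /eqP n0; rewrite nE n0 interp0.
have s1 : 1 - s != 0.
  by rewrite subr_eq0; apply: contra cc' => /eqP s1; rewrite sE -s1 interp1.
have e1 : (1 - t) * s * (1 - k) + t * (1 - s) * k = 0.
  apply: (mulfI D); rewrite mulr0 -[RHS]oppr0 -bca' tE sE kE /wedge /interp /=.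
  ring.
have e2 : (1 - t) * (1 - n) - t * n * (1 - s) = 0.
  apply: (mulfI D); rewrite mulr0 -[RHS]oppr0 -b'ca' tE nE sE /wedge /interp /=.
  ring.
have e3 : (1 - k) * n * s - k * (1 - n) = 0.
  apply: (mulfI D); rewrite mulr0 -paa kE nE sE /wedge /interp /=; ring.
have : 2 * (k * t * n * (1 - s)) = 0.
  have -> : 2 * (k * t * n * (1 - s)) =
    n * ((1 - t) * s * (1 - k) + t * (1 - s) * k)
    - (1 - t) * ((1 - k) * n * s - k * (1 - n))
    - k * ((1 - t) * (1 - n) - t * n * (1 - s)) by ring.
  by rewrite e1 e2 e3 !mulr0 !subr0.
by move/eqP; apply/negP; rewrite !mulf_neq0 ?pnatr_eq0.
Qed.

(** The eight collinearities form the Moebius-Kantor configuration.  With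
respect to the affine frame [p a b], three of them become the equations [e1],
[e2] and [e3] in the parameters of the other points.  Multiplying [e1] by [e2]
and substituting [e3] gives [(X + Y) ^+ 2 = X * Y], so [X / Y] would be a
primitive cube root of unity. *)
Lemma moebius_kantor (F : realFieldType) (p a a' b b' c c' z : F * F) :
  wedge p a b != 0 -> p != a' -> b != b' -> a != c -> p != c' -> a != z ->
  p != c -> a != b' ->
  wedge p a a' = 0 -> wedge p b b' = 0 -> wedge p c c' = 0 ->
  wedge a b c = 0 -> wedge a b' z = 0 ->
  wedge a' c z = 0 -> wedge b c' z = 0 -> wedge a' b' c' != 0.
Proof.
move=> D pa' bb' ac pc' az pc ab' paa pbb pcc abc ab'z a'cz bc'z.
apply/negP => /eqP a'b'c'.
have [pa pb ab] := wedge_neq0 D.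
have [s sE] := wedge0_interp pa paa.
have [t tE] := wedge0_interp pb pbb.
have [k kE] := wedge0_interp ab abc.
have [m mE] := wedge0_interp pc pcc.
have [l lE] := wedge0_interp ab' ab'z.
have s0 : s != 0 by apply: contra pa' => /eqP s0; rewrite sE s0 interp0.
have t1 : 1 - t != 0.
  by rewrite subr_eq0; apply: contra bb' => /eqP t1; rewrite tE -t1 interp1.
have k0 : k != 0 by apply: contra ac => /eqP k0; rewrite kE k0 interp0.
have m0 : m != 0 by apply: contra pc' => /eqP m0; rewrite mE m0 interp0.
have l0 : l != 0 by apply: contra az => /eqP l0; rewrite lE l0 interp0.
pose X := s * (1 - t) * k; pose Y := (1 - s) * t * (1 - k).
have e1 : s * t * (1 - m) = m * (X + Y).
  apply: (mulfI D); apply/eqP; rewrite -subr_eq0 -a'b'c'.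
  rewrite sE tE mE kE /X /Y /wedge /interp /=; apply/eqP; ring.
have e2 : (1 - l) * (1 - s) * k = l * (X + Y).
  apply: (mulfI D); apply/eqP; rewrite -subr_eq0 -oppr_eq0 -a'cz.
  rewrite sE lE tE kE /X /Y /wedge /interp /=; apply/eqP; ring.
have e3 : (1 - l) * (1 - m) = l * m * (1 - t) * (1 - k).
  apply: (mulfI D); apply/eqP; rewrite -subr_eq0 -bc'z.
  rewrite lE mE tE kE /X /Y /wedge /interp /=; apply/eqP; ring.
have lm0 : l * m != 0 by rewrite mulf_neq0.
have XY : X ^+ 2 + X * Y + Y ^+ 2 = 0.
  have e4 : (X + Y) ^+ 2 = X * Y.
    apply: (mulfI lm0).
    have -> : l * m * (X + Y) ^+ 2 = (m * (X + Y)) * (l * (X + Y)) by ring.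
    rewrite -e1 -e2.
    have -> : s * t * (1 - m) * ((1 - l) * (1 - s) * k) =
      s * t * (1 - s) * k * ((1 - l) * (1 - m)) by ring.
    by rewrite e3 /X /Y; ring.
  have -> : X ^+ 2 + X * Y + Y ^+ 2 = (X + Y) ^+ 2 - X * Y by ring.
  by rewrite e4 subrr.
have X0 : X != 0 by rewrite !mulf_neq0.
have : 0 < X ^+ 2 by rewrite exprn_even_gt0.
have := sqr_ge0 (X + 2 * Y).
have -> : (X + 2 * Y) ^+ 2 = 4 * (X ^+ 2 + X * Y + Y ^+ 2) - 3 * X ^+ 2 by ring.
rewrite XY; lra.
Qed.

(** * Small point sets whose points lie on three rich lines *)

Section Combinatorics.
Context {F : realFieldType} {T : finType} (h : T -> F * F) (A : {set T}).

Definition collin x y z := wedge (h x) (h y) (h z) == 0.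

(** For [x != y]: the line through these points is rich in [A]. *)
Definition joined x y :=
  [exists w in A, [&& w != x, w != y & collin x y w]].

Definition collinear_pair p a a' :=
  [&& a \in A, a' \in A, p != a, p != a', a != a' & collin p a a'].

(** Phrased with two further points on each line, which is the form in which
the three lines are used. *)
Definition on_three_lines p := exists a a' b b' c c',
  [/\ collinear_pair p a a', collinear_pair p b b', collinear_pair p c c' &
      [/\ ~~ collin p a b, ~~ collin p a c & ~~ collin p b c]].

Lemma collin_rot x y z : collin x y z = collin y z x.
Proof. by rewrite /collin wedge_rot. Qed.

Lemma collin_swap x y z : collin x y z = collin y x z.
Proof. by rewrite /collin wedge_swap oppr_eq0. Qed.

Lemma collin_swapr x y z : collin x y z = collin x z y.
Proof. by rewrite -collin_rot collin_swap. Qed.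

Lemma collinxx x y : collin x x y.
Proof. by rewrite /collin /wedge !subrr !mul0r subrr. Qed.

Lemma collinxyx x y : collin x y x.
Proof. by rewrite -collin_rot collinxx. Qed.

Lemma collinxyy x y : collin x y y.
Proof. by rewrite collin_rot collinxx. Qed.

Ltac neq_sym := first [ assumption | rewrite eq_sym; assumption ].

Ltac collin_perm :=
  first [ exact: collinxx | exact: collinxyx | exact: collinxyy | assumption
        | rewrite collin_rot; assumption | rewrite -collin_rot; assumption
        | rewrite collin_swap; assumption
        | rewrite collin_rot collin_swap; assumption
        | rewrite -collin_rot collin_swap; assumption ].

Hypothesis h_inj : injective h.

Lemma collin_trans x y u v w :
  x != y -> collin x y u -> collin x y v -> collin x y w -> collin u v w.
Proof.
move=> xy /eqP cu /eqP cv /eqP cw; apply/eqP; apply: (wedge0_trans _ cu cv cw).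
by rewrite (inj_eq h_inj).
Qed.

Lemma collin_quadrangle p b b' c c' a a' :
  ~~ collin p b c -> p != b' -> b != a -> b != a' -> c != c' -> b != c' ->
  collin p b b' -> collin p c c' -> collin b c a -> collin b' c' a ->
  collin b c' a' -> collin b' c a' -> ~~ collin p a a'.
Proof.
rewrite -!(inj_eq h_inj) => D pb' ba ba' cc' bc' /eqP pbb /eqP pcc /eqP bca.
move=> /eqP b'c'a /eqP bc'a' /eqP b'ca'.
exact: (@complete_quadrangle _ (h p) (h b) (h b') (h c) (h c') (h a) (h a')).
Qed.

Lemma collin_moebius_kantor p a a' b b' c c' z :
  ~~ collin p a b -> p != a' -> b != b' -> a != c -> p != c' -> a != z ->
  p != c -> a != b' ->
  collin p a a' -> collin p b b' -> collin p c c' -> collin a b c ->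
  collin a b' z -> collin a' c z -> collin b c' z -> ~~ collin a' b' c'.
Proof.
rewrite -!(inj_eq h_inj) => D pa' bb' ac pc' az pc ab' /eqP paa /eqP pbb.
move=> /eqP pcc /eqP abc /eqP ab'z /eqP a'cz /eqP bc'z.
exact: (@moebius_kantor _ (h p) (h a) (h a') (h b) (h b') (h c) (h c') (h z)).
Qed.

(* From here on only the incidence laws above are used, not coordinates. *)
Local Opaque collin.

Lemma collin_trans3 x y u v :
  x != y -> collin x y u -> collin x y v -> collin x u v.
Proof. by move=> xy; apply: collin_trans => //; apply: collinxyx. Qed.

Lemma uniq_size_card (s : seq T) :
  uniq s -> {subset s <= A} -> (size s <= #|A|)%N.
Proof.
move=> us sA; rewrite cardE; apply: uniq_leq_size => // x /sA.
by rewrite mem_enum.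
Qed.

Lemma uniq_full (s : seq T) :
  uniq s -> {subset s <= A} -> (#|A| <= size s)%N -> {subset A <= s}.
Proof.
move=> us sA As x xA.
have [_ ->] := uniq_min_size us (s2 := enum A) (fun x xs =>
  etrans (mem_enum A x) (sA x xs)) (leq_trans (eq_leq (esym (cardE _))) As).
by rewrite mem_enum.
Qed.

Lemma pencil_uniq p a a' b b' c c' :
  collinear_pair p a a' -> collinear_pair p b b' -> collinear_pair p c c' ->
  ~~ collin p a b -> ~~ collin p a c -> ~~ collin p b c ->
  uniq [:: p; a; a'; b; b'; c; c'].
Proof.
have off x x' y y' : collinear_pair p x x' -> collinear_pair p y y' ->
    ~~ collin p x y -> [&& x != y, x != y', x' != y & x' != y'].
  case/and5P=> _ _ px px' /andP[xx' pxx'] /and5P[_ _ py py' /andP[yy' pyy']] xy.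
  apply/and4P; split; apply: contra xy => /eqP e.
  - by rewrite e; collin_perm.
  - by rewrite e; collin_perm.
  - by rewrite -e; collin_perm.
  - rewrite -e in pyy'; apply: (@collin_trans x' p); last by collin_perm.
    + by rewrite eq_sym.
    + by collin_perm.
    + by collin_perm.
move=> pa pb pc ab ac bc.
have := off _ _ _ _ pa pb ab; have := off _ _ _ _ pa pc ac.
have := off _ _ _ _ pb pc bc.
case/and5P: pa => _ _ ? ? /andP[? _]; case/and5P: pb => _ _ ? ? /andP[? _].
case/and5P: pc => _ _ ? ? /andP[? _].
case/and4P=> ? ? ? ? /and4P[? ? ? ?] /and4P[? ? ? ?].
by rewrite /= !inE !negb_or; do ![apply/andP; split].
Qed.

Hypothesis A8 : (#|A| <= 8)%N.
Hypothesis A_pencils : {in A, forall p, on_three_lines p}.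

(** The three lines through [x] carry [x] and six other points, so at most one
point of [A] lies on none of them. *)
Lemma two_neighbours x y z :
  x \in A -> y \in A -> z \in A -> x != y -> x != z -> y != z ->
  joined x y || joined x z.
Proof.
move=> xA yA zA xy xz yz.
have [a [a' [b [b' [c [c' [pa pb pc [ab ac bc]]]]]]]] := A_pencils xA.
have uL := pencil_uniq pa pb pc ab ac bc.
set L := [:: a; a'; b; b'; c; c'].
have pairL u u' : collinear_pair x u u' -> joined x u /\ joined x u'.
  case/and5P=> uA u'A xu xu' /andP[uu' xuu'].
  split; apply/exists_inP; [exists u' | exists u] => //;
    by apply/and3P; split; (neq_sym || collin_perm).
have onL w : w \in L -> joined x w.
  rewrite !inE; have [? ?] := pairL _ _ pa; have [? ?] := pairL _ _ pb.
  by have [? ?] := pairL _ _ pc; do 5?[case/orP]; move/eqP=> ->.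
have [/onL -> // | yL] := boolP (y \in L).
have [/onL ->| zL] := boolP (z \in L); first by rewrite orbT.
have : uniq [:: y, z, x & L].
  move: yL zL; rewrite 2!cons_uniq uL !inE !negb_or => -> ->.
  by rewrite yz (eq_sym y) xy (eq_sym z) xz.
move=> uS; suff /(uniq_size_card uS)/leq_trans/(_ A8) :
  {subset [:: y, z, x & L] <= A} by [].
move=> w.
case/and5P: pa => ? ? _ _ _; case/and5P: pb => ? ? _ _ _.
case/and5P: pc => ? ? _ _ _.
by rewrite !inE; do 8?[case/orP]; move/eqP=> ->.
Qed.

(** The third point on the line [x b] can lie neither on the line [p x] nor on
[p b], so it is [c] or [c']. *)
Lemma meets_opposite_side p x b b' c c' :
  p \in A -> b \in A -> p != b' -> b != b' -> collin p b b' ->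
  ~~ collin p x b ->
  (forall w, w \in A -> (w \in [:: b; b'; c; c']) || collin p x w) ->
  joined x b -> collin x b c || collin x b c'.
Proof.
move=> pA bA pb' bb' pbb' xb cov /exists_inP[w wA /and3P[wx wb xbw]].
have xne : x != b by apply: contra xb => /eqP ->; collin_perm.
have := cov _ wA; rewrite !inE (negPf wb) /=.
case/orP; first (case/or3P => /eqP e; subst w).
- case/negP: xb.
  have : collin b x p by apply: (@collin_trans b b') => //; collin_perm.
  by move=> ?; collin_perm.
- by rewrite xbw.
- by rewrite xbw orbT.
move=> pxw; case/negP: xb; apply: (@collin_trans x w); first by rewrite eq_sym.
all: collin_perm.
Qed.

(** By [meets_opposite_side], the points among [b], [b'], [c], [c'] that are
joined to [x] are matched in pairs by their joins.  By [two_neighbours] at most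
one of the four is not joined to [x], hence none. *)
Lemma quadrangle_matching p x b b' c c' :
  p \in A -> x \in A ->
  collinear_pair p b b' -> collinear_pair p c c' -> ~~ collin p b c ->
  ~~ collin p x b -> ~~ collin p x c ->
  (forall w, w \in A -> (w \in [:: b; b'; c; c']) || collin p x w) ->
  collin x b c && collin x b' c' || collin x b c' && collin x b' c.
Proof.
move=> pA xA /and5P[bA b'A pb pb' /andP[bb' pbb']].
move=> /and5P[cA c'A pc pc' /andP[cc' pcc']] bc xb xc cov.
have xb' : ~~ collin p x b'.
  apply: contra xb => xb'.
  by apply: (@collin_trans p b') => //; collin_perm.
have xc' : ~~ collin p x c'.
  apply: contra xc => xc'.
  by apply: (@collin_trans p c') => //; collin_perm.
have ne y : ~~ collin p x y -> x != y.
  by apply: contra => /eqP <-; rewrite collinxyy.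
have b'b : b' != b by rewrite eq_sym.
have c'c : c' != c by rewrite eq_sym.
have sideE s w : perm_eq s [:: b; b'; c; c'] ->
    w \in A -> (w \in s) || collin p x w.
  by move=> /perm_mem -> /cov.
have adj_b : joined x b -> collin x b c || collin x b c'.
  by apply: (@meets_opposite_side p x b b' c c').
have adj_b' : joined x b' -> collin x b' c || collin x b' c'.
  apply: (@meets_opposite_side p x b' b) => //; first by collin_perm.
  by move=> w; apply: sideE; apply/permP => P /=; ring.
have adj_c : joined x c -> collin x b c || collin x b' c.
  move=> xc1; have : collin x c b || collin x c b'.
    apply: (@meets_opposite_side p x c c') => // w.
    by apply: sideE; apply/permP => P /=; ring.
  by case/orP=> ?; apply/orP; [left | right]; collin_perm.
have adj_c' : joined x c' -> collin x b c' || collin x b' c'.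
  move=> xc1; have : collin x c' b || collin x c' b'.
    apply: (@meets_opposite_side p x c' c) => //; first by collin_perm.
    by move=> w; apply: sideE; apply/permP => P /=; ring.
  by case/orP=> ?; apply/orP; [left | right]; collin_perm.
have not_both u v v' : ~~ collin p x v -> x != u -> v != v' -> collin p v v' ->
    ~~ (collin x u v && collin x u v').
  move=> xv xu vv' pvv'; apply: contra xv => /andP[xuv xuv'].
  have xvv' : collin x v v' by apply: (@collin_trans x u) => //; collin_perm.
  by apply: (@collin_trans v v') => //; collin_perm.
have n_b := not_both b c c' xc (ne _ xb) cc' pcc'.
have n_b' := not_both b' c c' xc (ne _ xb') cc' pcc'.
have n_c : ~~ (collin x b c && collin x b' c).
  apply: contra (not_both c b b' xb (ne _ xc) bb' pbb') => /andP[? ?].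
  by apply/andP; split; collin_perm.
have n_c' : ~~ (collin x b c' && collin x b' c').
  apply: contra (not_both c' b b' xb (ne _ xc') bb' pbb') => /andP[? ?].
  by apply/andP; split; collin_perm.
have := two_neighbours xA bA b'A (ne _ xb) (ne _ xb') bb'.
have := two_neighbours xA cA c'A (ne _ xc) (ne _ xc') cc'.
have b_c : b != c by apply: contra bc => /eqP ->; collin_perm.
have b_c' : b != c' by apply: contra bc => /eqP ->; collin_perm.
have b'_c : b' != c by apply: contra bc => /eqP <-; collin_perm.
have b'_c' : b' != c'.
  apply: contra bc => /eqP e; rewrite -e in pcc'.
  by apply: (@collin_trans3 p b') => //; collin_perm.
have := two_neighbours xA bA cA (ne _ xb) (ne _ xc) b_c.
have := two_neighbours xA bA c'A (ne _ xb) (ne _ xc') b_c'.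
have := two_neighbours xA b'A cA (ne _ xb') (ne _ xc) b'_c.
have := two_neighbours xA b'A c'A (ne _ xb') (ne _ xc') b'_c'.
move: (introT implyP adj_b) (introT implyP adj_b').
move: (introT implyP adj_c) (introT implyP adj_c') n_b n_b' n_c n_c'.
case: (joined x b); case: (joined x b');
case: (joined x c); case: (joined x c') => //;
by case: (collin x b c); case: (collin x b' c); case: (collin x b c');
   case: (collin x b' c').
Qed.

(** Of the three perfect matchings of [b b' c c'], the point [p] induces one, so
[a] and [a'] induce the two others, distinct because the line through [p] meets
each side only once.  Thus [p], [a] and [a'] are the diagonal points of the
quadrangle. *)
Lemma no_line_beside_quadrangle p a a' b b' c c' :
  p \in A -> collinear_pair p a a' ->
  collinear_pair p b b' -> collinear_pair p c c' ->
  ~~ collin p a b -> ~~ collin p a c -> ~~ collin p b c ->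
  (forall w, w \in A -> (w \in [:: b; b'; c; c']) || collin p a w) -> False.
Proof.
move=> pA /and5P[aA a'A pa pa' /andP[aa' paa']] pbb' pcc' ab ac bc cov.
have linea' w : collin p a' w = collin p a w.
  by apply/idP/idP=> ?;
    [apply: (@collin_trans p a') | apply: (@collin_trans p a)];
    rewrite // ?collinxyx //; collin_perm.
have a'b : ~~ collin p a' b by rewrite linea'.
have a'c : ~~ collin p a' c by rewrite linea'.
have cov' w : w \in A -> (w \in [:: b; b'; c; c']) || collin p a' w.
  by rewrite linea'; apply: cov.
have Ma := quadrangle_matching pA aA pbb' pcc' bc ab ac cov.
have Ma' := quadrangle_matching pA a'A pbb' pcc' bc a'b a'c cov'.
case/and5P: pbb' => bA b'A pb pb' /andP[bb' pbb'].
case/and5P: pcc' => cA c'A pc pc' /andP[cc' pcc'].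
have bc' : b != c' by apply: contra bc => /eqP ->; collin_perm.
have quad x x' : collin p x x' -> ~~ collin p x b -> ~~ collin p x' b ->
    collin x b c -> collin x b' c' -> collin x' b c' -> collin x' b' c -> False.
  move=> xx' xb x'b xbc xb'c' x'bc' x'b'c.
  have bx : b != x by apply: contra xb => /eqP ->; collin_perm.
  have bx' : b != x' by apply: contra x'b => /eqP ->; collin_perm.
  suff /negP[] : ~~ collin p x x' by [].
  by apply: (@collin_quadrangle p b b' c c' x x') => //; collin_perm.
have b_c : b != c by apply: contra bc => /eqP ->; collin_perm.
have distinct u : b != u -> collin a b u -> collin a' b u -> False.
  move=> bu abu a'bu; case/negP: ab.
  have aa'b : collin a a' b by apply: (@collin_trans b u) => //; collin_perm.
  by apply: (@collin_trans a a') => //; collin_perm.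
case/orP: Ma => /andP[M1 M2]; case/orP: Ma' => /andP[M3 M4].
- exact: (distinct c).
- exact: (quad a a').
- by apply: (quad a' a) => //; collin_perm.
- exact: (distinct c').
Qed.

(** If the line is one of the three lines through [x], the two others carry four
points off it, and there is no room for more: [no_line_beside_quadrangle]
applies.  Otherwise [y] and [u] lie on none of the three lines, and there are
at least nine points. *)
Lemma no_four_collinear x y u v :
  collin x y u -> collin x y v -> uniq [:: x; y; u; v] ->
  {subset [:: x; y; u; v] <= A} -> False.
Proof.
move=> xyu xyv uxy sub.
have [xA yA uA vA] : [/\ x \in A, y \in A, u \in A & v \in A].
  by split; apply: sub; rewrite !inE eqxx ?orbT.
have [a [a' [b [b' [c [c' [pa pb pc [ab ac bc]]]]]]]] := A_pencils xA.
have uL := pencil_uniq pa pb pc ab ac bc.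
have := uxy; rewrite /= !inE !negb_or.
case/and4P=> /and3P[xy xu xv] /andP[yu yv] uv _.
have off_pencil_line d d' e e' g g' : collinear_pair x d d' ->
    collinear_pair x e e' -> collinear_pair x g g' ->
    ~~ collin x d e -> ~~ collin x d g -> ~~ collin x e g -> ~~ collin x d y.
  move=> xdd' xee' xgg' de dg eg; apply/negP => xdy.
  have /and5P[dA d'A xd xd' /andP[dd' cdd']] := xdd'.
  have line w : collin x y w = collin x d w.
    by apply/idP/idP=> ?;
      [apply: (@collin_trans x y) | apply: (@collin_trans x d)];
      rewrite // ?collinxyx //; collin_perm.
  apply: (@no_line_beside_quadrangle x y u e e' g g') => //.
  - by apply/and5P; split=> //; apply/andP.
  - by rewrite line.
  - by rewrite line.
  have off e1 e2 :
      collinear_pair x e1 e2 -> ~~ collin x d e1 -> ~~ collin x d e2.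
    case/and5P=> _ _ _ xe2 /andP[_ e12]; apply: contra => de2.
    by apply: (@collin_trans x e2) => //; collin_perm.
  have off_s w : w \in [:: e; e'; g; g'] -> ~~ collin x d w.
    by rewrite !inE => /or4P[] /eqP -> //; [apply: (off e) | apply: (off g)].
  have on_s w : w \in [:: x; y; u; v] -> collin x d w.
    by rewrite -line !inE => /or4P[] /eqP -> //; collin_perm.
  have us : uniq ([:: x; y; u; v] ++ [:: e; e'; g; g']).
    rewrite cat_uniq uxy andTb; apply/andP; split.
      by apply/hasPn => w /off_s; apply: contra => /on_s.
    by case/and4P: (pencil_uniq xdd' xee' xgg' de dg eg).
  have sA : {subset [:: x; y; u; v] ++ [:: e; e'; g; g'] <= A}.
    move=> w; rewrite mem_cat => /orP[/sub // |].
    case/and5P: xee' => ? ? _ _ _; case/and5P: xgg' => ? ? _ _ _.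
    by rewrite !inE => /or4P[] /eqP ->.
  move=> w /(uniq_full us sA A8); rewrite mem_cat => /orP[/on_s | ->] //.
  by rewrite line => ->; rewrite orbT.
have ya : ~~ collin x a y by apply: (off_pencil_line a a' b b' c c').
have yb : ~~ collin x b y.
  by apply: (off_pencil_line b b' a a' c c') => //; rewrite collin_swapr.
have yc : ~~ collin x c y.
  by apply: (off_pencil_line c c' a a' b b') => //; rewrite collin_swapr.
have off w : w != x -> collin x y w -> w \notin [:: a; a'; b; b'; c; c'].
  move=> wx xyw.
  have off d d' :
      collinear_pair x d d' -> ~~ collin x d y -> (w != d) && (w != d').
    case/and5P=> _ _ xd xd' /andP[dd' xdd'] xdy.
    apply/andP; split; apply: contra xdy => /eqP e; rewrite e in xyw.
      by collin_perm.
    by apply: (@collin_trans x d') => //; collin_perm.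
  rewrite !inE !negb_or.
  case/andP: (off _ _ pa ya) => -> ->; case/andP: (off _ _ pb yb) => -> ->.
  by case/andP: (off _ _ pc yc) => -> ->.
have yx : y != x by rewrite eq_sym.
have ux : u != x by rewrite eq_sym.
have /uniq_size_card us : uniq [:: y, u & [:: x; a; a'; b; b'; c; c']].
  move: (off y yx (collinxyy _ _)) (off u ux xyu).
  rewrite 2!cons_uniq uL (in_cons u) !(in_cons x) !negb_or => -> ->.
  by rewrite yu yx ux.
suff /us/leq_trans/(_ A8) :
  {subset [:: y, u & [:: x; a; a'; b; b'; c; c']] <= A} by [].
case/and5P: pa => ? ? _ _ _; case/and5P: pb => ? ? _ _ _.
case/and5P: pc => ? ? _ _ _.
by move=> w; rewrite !inE; do 8?[case/orP]; move/eqP=> ->.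
Qed.

Lemma no_four_distinct_collinear x y u v :
  collin x y u -> collin x y v -> x \in A -> y \in A -> u \in A -> v \in A ->
  x != y -> x != u -> x != v -> y != u -> y != v -> u != v -> False.
Proof.
move=> xyu xyv xA yA uA vA xy xu xv yu yv uv.
apply: (no_four_collinear xyu xyv).
  by rewrite /= !inE !negb_or xy xu xv yu yv uv.
by move=> w; rewrite !inE => /or4P[] /eqP ->.
Qed.

(** The incidence arguments below have a single source of contradiction: two
collinear triples that share two points and differ in the third.
[four_collinear] looks for such a pair among the hypotheses, up to the order of
the points. *)
Ltac four_points C1 C2 :=
  apply: (no_four_distinct_collinear C1 C2);
  first [ assumption | rewrite eq_sym; assumption ].

Ltac four_collinear_on x y C1 H2 :=
  match type of H2 with
  | is_true (collin x y ?v) => four_points C1 H2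
  | is_true (collin y x ?v) => four_points C1 (etrans (collin_swap x y v) H2)
  | is_true (collin x ?v y) => four_points C1 (etrans (collin_swapr x y v) H2)
  | is_true (collin ?v x y) =>
      four_points C1 (etrans (esym (collin_rot v x y)) H2)
  | is_true (collin y ?v x) => four_points C1 (etrans (collin_rot x y v) H2)
  | is_true (collin ?v y x) =>
      four_points C1
        (etrans (collin_swap x y v) (etrans (esym (collin_rot v y x)) H2))
  end.

Ltac four_collinear :=
  exfalso; match goal with
  | H1 : is_true (collin ?x ?y ?u), H2 : is_true (collin _ _ _) |- _ =>
    first [ four_collinear_on x y H1 H2
          | four_collinear_on y u (etrans (esym (collin_rot x y u)) H1) H2
          | four_collinear_on u x (etrans (collin_rot u x y) H1) H2 ]
  end.

(** The point [p], its three lines, and the remaining point [z]. *)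
Definition frame p a a' b b' c c' z :=
  [/\ uniq [:: p; a; a'; b; b'; c; c'; z],
      all [in A] [:: p; a; a'; b; b'; c; c'; z],
      forall w, w \in A -> w \in [:: p; a; a'; b; b'; c; c'; z] &
      [/\ collin p a a', collin p b b' & collin p c c']].

(** From [joined x y], runs through the points that could be the third one on
that line and discards those that would create four collinear points. *)
Ltac third_point cov H :=
  let w := fresh "w" in let wA := fresh "wA" in let e := fresh "e" in
  case/exists_inP: H => w wA /and3P[? ? ?];
  move: (cov w wA);
  rewrite !inE; do 7?[case/orP]; move/eqP=> e; subst w;
  try match goal with H : is_true (?u != ?u) |- _ => by rewrite eqxx in H end;
  try four_collinear.

Ltac open_frame cov :=
  case=> + + cov [? ? ?]; rewrite /= !inE !negb_or => *;
  repeat match goal with H : is_true (_ && _) |- _ => case/andP: H => ? ? end.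

Lemma frame_perm p a a' b b' c c' d d' e e' g g' z :
  frame p a a' b b' c c' z ->
  perm_eq [:: a; a'; b; b'; c; c'] [:: d; d'; e; e'; g; g'] ->
  collin p d d' -> collin p e e' -> collin p g g' -> frame p d d' e e' g g' z.
Proof.
case=> uL sub cov _ pL pd pe pg.
have pE : perm_eq [:: p; a; a'; b; b'; c; c'; z] [:: p; d; d'; e; e'; g; g'; z].
  rewrite perm_cons -[X in perm_eq X]/([:: a; a'; b; b'; c; c'] ++ [:: z]).
  rewrite -[X in perm_eq _ X]/([:: d; d'; e; e'; g; g'] ++ [:: z]).
  by rewrite perm_cat2r.
split=> //.
- by rewrite -(perm_uniq pE).
- by rewrite -(perm_all _ pE).
- by move=> w /cov; rewrite (perm_mem pE).
Qed.

(** A line through [p] and [z] with a third point would be one of the three lines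
through [p], and carry four points. *)
Lemma frame_antipode p a a' b b' c c' z :
  frame p a a' b b' c c' z -> ~~ joined p z.
Proof.
by open_frame cov; apply/negP => H; third_point cov H.
Qed.

(** Since [p] and [z] are not joined, [two_neighbours] joins [z] to every other
point: the lines through [z] match the six points [a a' b b' c c'], never
pairing two points on a line through [p]. *)
Lemma frame_neighbour p a a' b b' c c' z y :
  frame p a a' b b' c c' z -> y \in [:: a; a'; b; b'; c; c'] ->
  joined z y.
Proof.
move=> fr yL; have pz := frame_antipode fr.
have zp : ~~ joined z p.
  apply: contra pz => /exists_inP[w wA /and3P[? ? ?]].
  by apply/exists_inP; exists w => //; apply/and3P; split=> //; collin_perm.
have : [&& z != p, z != y & p != y] && [&& z \in A, p \in A & y \in A].
  move: fr; open_frame cov.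
  move: yL; rewrite !inE; do 5?[case/orP] => /eqP ->;
  by do ![apply/andP; split]; neq_sym.
case/andP=> /and3P[? ? ?] /and3P[zA pA yA].
by have := two_neighbours zA pA yA; rewrite (negPf zp); apply.
Qed.

(** Here the third line through [z] is [z b c'].  The third lines through [a]
and [a'] are then forced to be [a b c] and [a' b' c'], which completes the
Moebius-Kantor configuration. *)
Lemma frame_false_zab'_za'c p a a' b b' c c' z :
  frame p a a' b b' c c' z -> collin z a b' -> collin z a' c -> False.
Proof.
move=> fr zab' za'c.
have zb : joined z b by apply: (frame_neighbour fr); rewrite !inE eqxx ?orbT.
move: fr; open_frame cov.
have zbc' : collin z b c' by third_point cov zb.
have abc : collin a b c.
  have /orP[H | H] : joined a b || joined a c.
    exact: two_neighbours.
    by third_point cov H.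
  by third_point cov H; collin_perm.
have a'b'c' : collin a' b' c'.
  have /orP[H | H] : joined a' b' || joined a' c'.
    exact: two_neighbours.
    by third_point cov H.
  by third_point cov H; collin_perm.
have ab : ~~ collin p a b by apply/negP => ?; four_collinear.
suff /negP : ~~ collin a' b' c' by [].
by apply: (@collin_moebius_kantor p a a' b b' c c' z) => //; collin_perm.
Qed.

(** On the lines through [z], the partner of [a'] is [b], [c] or [c']; it is not
[b], which would leave [c] without a partner. *)
Lemma frame_false_zab' p a a' b b' c c' z :
  frame p a a' b b' c c' z -> collin z a b' -> False.
Proof.
move=> fr zab'.
have za' : joined z a'.
  by apply: (frame_neighbour fr); rewrite !inE eqxx ?orbT.
have zc : joined z c.
  by apply: (frame_neighbour fr); rewrite !inE eqxx ?orbT.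
move: (fr); open_frame cov.
third_point cov za'.
- third_point cov zc.
- exact: (frame_false_zab'_za'c fr).
apply: (@frame_false_zab'_za'c p a a' b b' c' c z) => //.
by apply: (frame_perm fr); (collin_perm || (apply/permP => P /=; ring)).
Qed.

(** The symmetries of the frame exchange the lines through [p] and the two
points on each of them, so the partner of [a] on its line through [z] may be
taken to be [b']. *)
Lemma no_frame p a a' b b' c c' z : frame p a a' b b' c c' z -> False.
Proof.
move=> fr.
have za : joined z a.
  by apply: (frame_neighbour fr); rewrite !inE eqxx ?orbT.
move: (fr); open_frame cov.
third_point cov za.
- apply: (@frame_false_zab' p a a' b' b c c' z) => //.
  by apply: (frame_perm fr); (collin_perm || (apply/permP => P /=; ring)).
- exact: (frame_false_zab' fr).
- apply: (@frame_false_zab' p a a' c' c b b' z) => //.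
  by apply: (frame_perm fr); (collin_perm || (apply/permP => P /=; ring)).
- apply: (@frame_false_zab' p a a' c c' b b' z) => //.
  by apply: (frame_perm fr); (collin_perm || (apply/permP => P /=; ring)).
Qed.

Lemma pencils_empty : A = set0.
Proof.
apply/setP => p; rewrite inE; apply/negbTE/negP => pA.
have [a [a' [b [b' [c [c' [pa pb pc [ab ac bc]]]]]]]] := A_pencils pA.
have uL := pencil_uniq pa pb pc ab ac bc.
have LA : {subset [:: p; a; a'; b; b'; c; c'] <= A}.
  case/and5P: pa => ? ? _ _ _; case/and5P: pb => ? ? _ _ _.
  case/and5P: pc => ? ? _ _ _.
  by move=> w; rewrite !inE; do 6?[case/orP]; move/eqP=> ->.
have [/subsetP AL | /subsetPn[z zA zL]] :=
  boolP (A \subset [:: p; a; a'; b; b'; c; c']).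
  apply: (no_line_beside_quadrangle pA pa pb pc ab ac bc) => w /AL.
  case/and5P: pa => _ _ _ _ /andP[_ paa'].
  rewrite !inE; do 6?[case/orP]; move/eqP=> ->; rewrite ?eqxx ?orbT //.
  - by rewrite collinxyx !orbT.
  - by rewrite collinxyy !orbT.
  - by rewrite paa' !orbT.
have us : uniq (rcons [:: p; a; a'; b; b'; c; c'] z) by rewrite rcons_uniq zL.
have sA : {subset rcons [:: p; a; a'; b; b'; c; c'] z <= A}.
  by move=> w; rewrite mem_rcons in_cons => /orP[/eqP -> | /LA].
apply: (@no_frame p a a' b b' c c' z); split=> //.
- by apply/allP.
- by move=> w; apply: uniq_full.
case/and5P: pa => _ _ _ _ /andP[_ ?]; case/and5P: pb => _ _ _ _ /andP[_ ?].
by case/and5P: pc => _ _ _ _ /andP[_ ?].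
Qed.

End Combinatorics.

(** * Rational sequences of points *)

Import numFieldNormedType.Exports.
Local Open Scope classical_set_scope.

Definition embed (R : realType) (u : rat * rat) : R * R := (ratr u.1, ratr u.2).

(** Coordinatewise convergence in the real plane of a sequence of rational
points. *)
Definition tends_to (R : realType) (u : nat -> rat * rat) (l : R * R) : Prop :=
  ((embed R (u n)).1 @[n --> \oo] --> l.1) /\
  ((embed R (u n)).2 @[n --> \oo] --> l.2).

Lemma wedge_embed (R : realType) (u v w : rat * rat) :
  wedge (embed R u) (embed R v) (embed R w) = ratr (wedge u v w).
Proof. by rewrite /wedge /embed /= rmorphB !rmorphM !rmorphB. Qed.

Lemma rat_sequence (R : realType) (x : R) :
  exists q : nat -> rat, ratr (q n) @[n --> \oo] --> x.
Proof.
have approx n : exists q : rat, `|x - ratr q| < harmonic n.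
  have lt : x - harmonic n < x + harmonic n by have := @harmonic_gt0 R n; lra.
  have [q] := rat_in_itvoo lt.
  rewrite in_itv /= => /andP[]; rewrite ltrBlDr -ltrBlDl => ? ?; exists q.
  by rewrite ltr_norml; apply/andP; split; rewrite // ltrNl opprB ltrBlDl.
have [q qE] := choice approx; exists q.
apply/cvgrPdist_lt => e e0.
have /cvgrPdist_lt/(_ e e0) := @cvg_harmonic R.
apply: filterS => n; rewrite sub0r normrN; apply: le_lt_trans.
by rewrite (ger0_norm (harmonic_ge0 n)) ltW.
Qed.

Lemma tends_to_wedge (R : realType) (u v w : nat -> rat * rat) (x y z : R * R) :
  tends_to u x -> tends_to v y -> tends_to w z ->
  ratr (wedge (u n) (v n) (w n)) @[n --> \oo] --> wedge x y z.
Proof.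
move=> [u1 u2] [v1 v2] [w1 w2].
under eq_fun do rewrite -wedge_embed.
by apply: cvgB; apply: cvgM; apply: cvgB.
Qed.

Lemma tends_to_interp (R : realType) (t : nat -> rat) (u v : nat -> rat * rat)
    (s : R) (x y : R * R) :
  ratr (t n) @[n --> \oo] --> s -> tends_to u x -> tends_to v y ->
  tends_to (fun n => interp (t n) (u n) (v n)) (interp s x y).
Proof.
move=> ts [u1 u2] [v1 v2]; split; rewrite /interp /embed /=.
all: under eq_fun do rewrite rmorphD rmorphM rmorphB.
all: by apply: cvgD => //; apply: cvgM => //; apply: cvgB.
Qed.

Lemma tends_to_neq (R : realType) (u v : nat -> rat * rat) (x y : R * R) :
  tends_to u x -> tends_to v y -> x != y -> \forall n \near \oo, u n != v n.
Proof.
move=> [u1 u2] [v1 v2] xy.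
have [e1|e1] := eqVneq (x.1 - y.1) 0.
  have e2 : x.2 - y.2 != 0.
    apply: contra xy; move/eqP: e1; rewrite !subr_eq0 => /eqP e1 /eqP e2.
    by rewrite (surjective_pairing x) (surjective_pairing y) e1 e2.
  have : \forall n \near \oo, (embed R (u n)).2 - (embed R (v n)).2 != 0.
    exact: (cvgr_neq0 _ (cvgB u2 v2)).
  by apply: filterS => n; apply: contra => /eqP ->; rewrite subrr.
have : \forall n \near \oo, (embed R (u n)).1 - (embed R (v n)).1 != 0.
  exact: (cvgr_neq0 _ (cvgB u1 v1)).
by apply: filterS => n; apply: contra => /eqP ->; rewrite subrr.
Qed.

(** The intersection of the lines [a a'] and [b b']: on the first line,
[wedge b b'] is an affine function of the parameter, with the values
[wedge b b' a] and [wedge b b' a'] at 0 and 1. *)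
Definition crossing (F : realFieldType) (a a' b b' : F * F) : F * F :=
  interp (wedge b b' a / (wedge b b' a - wedge b b' a')) a a'.

Lemma wedge_crossing (F : realFieldType) (a a' b b' : F * F) :
  wedge b b' a != wedge b b' a' -> wedge b b' (crossing a a' b b') = 0.
Proof.
rewrite -subr_eq0 /crossing => D; set t := _ / _.
have -> : wedge b b' (interp t a a') =
    wedge b b' a - t * (wedge b b' a - wedge b b' a').
  by rewrite /wedge /interp /=; ring.
by rewrite divfK // subrr.
Qed.

Lemma crossing_unique (F : realFieldType) (p a a' b b' : F * F) :
  a != a' -> wedge b b' a != 0 -> wedge a a' p = 0 -> wedge b b' p = 0 ->
  wedge b b' a != wedge b b' a' /\ p = crossing a a' b b'.
Proof.
move=> aa' ba aa'p bb'p; have [t pE] := wedge0_interp aa' aa'p.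
have e : wedge b b' a = t * (wedge b b' a - wedge b b' a').
  have : wedge b b' (interp t a a') = 0 by rewrite -pE.
  have -> : wedge b b' (interp t a a') =
    wedge b b' a - t * (wedge b b' a - wedge b b' a').
    by rewrite /wedge /interp /=; ring.
  by move/eqP; rewrite subr_eq0 => /eqP.
have D : wedge b b' a != wedge b b' a'.
  by apply: contra ba => /eqP D; rewrite e -D subrr mulr0.
split=> //; rewrite pE /crossing; congr interp.
by rewrite {1}e mulfK // subr_eq0.
Qed.

Lemma tends_to_crossing (R : realType) (u u' v v' : nat -> rat * rat)
    (x x' y y' : R * R) :
  wedge y y' x != wedge y y' x' ->
  tends_to u x -> tends_to u' x' -> tends_to v y -> tends_to v' y' ->
  tends_to (fun n => crossing (u n) (u' n) (v n) (v' n)) (crossing x x' y y').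
Proof.
move=> D cu cu' cv cv'; apply: tends_to_interp => //.
under eq_fun do rewrite fmorph_div (rmorphB _ (wedge _ _ _) (wedge _ _ _)).
have cw := tends_to_wedge cv cv' cu.
apply: cvgM => //; apply: cvgV; first by rewrite subr_eq0.
by apply: cvgB => //; apply: tends_to_wedge.
Qed.

Section Approximation.
Context {R : realType} {P : finType} (f : P -> R * R).
Hypothesis f_inj : injective f.

(** Collinearities need only persist eventually: at the first indices, the
approximations of two crossing lines may still be parallel. *)
Definition approximable (A : {set P}) := exists g : nat -> P -> rat * rat,
  (forall p, p \in A -> tends_to (g^~ p) (f p)) /\
  (forall x y z, x \in A -> y \in A -> z \in A -> collin f x y z ->
     \forall n \near \oo, collin (g n) x y z).

Lemma approximable_extend (A : {set P}) p (g : nat -> P -> rat * rat)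
    (q : nat -> rat * rat) :
  p \in A ->
  (forall x, x \in A :\ p -> tends_to (g^~ x) (f x)) ->
  (forall x y z, x \in A :\ p -> y \in A :\ p -> z \in A :\ p ->
     collin f x y z -> \forall n \near \oo, collin (g n) x y z) ->
  tends_to q (f p) ->
  (forall s t, collinear_pair f A p s t ->
     \forall n \near \oo, wedge (q n) (g n s) (g n t) == 0) ->
  approximable A.
Proof.
move=> pA gf gcol qp qcol.
pose g' n x := if x == p then q n else g n x.
have g'p n : g' n p = q n by rewrite /g' eqxx.
have g'x n x : x != p -> g' n x = g n x by rewrite /g' => /negbTE ->.
exists g'; split=> [x xA | x y z xA yA zA].
  rewrite /g'; have [-> // | xp] := eqVneq x p.
  by apply: gf; rewrite !inE xp.
have pcol s t : s \in A -> t \in A -> collin f p s t ->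
    \forall n \near \oo, collin (g' n) p s t.
  move=> sA tA pst.
  have [-> | sp] := eqVneq s p; first by apply: nearW => n; apply: collinxx.
  have [-> | tp] := eqVneq t p; first by apply: nearW => n; apply: collinxyx.
  have [-> | st] := eqVneq s t; first by apply: nearW => n; apply: collinxyy.
  have := qcol s t; rewrite /collinear_pair sA tA st pst (eq_sym p) sp.
  rewrite (eq_sym p) tp => /(_ isT); apply: filterS => n.
  by rewrite /collin g'p !g'x.
move=> xyz.
have [e | xp] := eqVneq x p; first by rewrite e in xyz *; apply: pcol.
have [e | yp] := eqVneq y p.
  rewrite e in xyz *; rewrite collin_swap in xyz.
  by apply: filterS (pcol _ _ xA zA xyz) => n; rewrite collin_swap.
have [e | zp] := eqVneq z p.
  rewrite e in xyz *; rewrite -collin_rot in xyz.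
  by apply: filterS (pcol _ _ xA yA xyz) => n ?; rewrite -collin_rot.
have := gcol x y z; rewrite !inE xA yA zA xp yp zp => /(_ isT isT isT xyz).
by apply: filterS => n; rewrite /collin !g'x.
Qed.

Lemma approximable_set0 : approximable set0.
Proof. by exists (fun _ _ => 0); split=> ?; rewrite inE. Qed.

(** Rich lines through [p] are picked one at a time, each off the previous ones;
the three cases are the stages at which this can stop. *)
Lemma at_most_two_lines (A : {set P}) p : ~ on_three_lines f A p ->
  [\/ forall s t, ~~ collinear_pair f A p s t,
      exists a a', collinear_pair f A p a a' /\
        forall s t, collinear_pair f A p s t -> collin f p a s |
      exists a a' b b',
        [/\ collinear_pair f A p a a', collinear_pair f A p b b',
            ~~ collin f p a b &
            forall s t, collinear_pair f A p s t ->
              collin f p a s || collin f p b s]].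
Proof.
move=> no3.
have [/existsP[a /existsP[a' pa]] | no1] :=
  boolP [exists a, exists a', collinear_pair f A p a a']; last first.
  constructor 1 => s t; apply: contra no1 => ?.
  by apply/existsP; exists s; apply/existsP; exists t.
have [/existsP[b /existsP[b' /andP[pb ab]]] | no2] :=
  boolP [exists b, exists b', collinear_pair f A p b b' && ~~ collin f p a b];
  last first.
  constructor 2; exists a, a'; split=> // s t pst; apply: contraR no2 => ?.
  by apply/existsP; exists s; apply/existsP; exists t; rewrite pst.
constructor 3; exists a, a', b, b'; split=> // c c' pc.
apply: contra_notT no3; rewrite negb_or => /andP[ac bc].
by exists a, a', b, b', c, c'.
Qed.

(** Whichever rational sequence is chosen for [p], it lies on the approximations
of the rich lines through [p]; the other points of such a line follow it by
[gcol], because two of its points determine the line. *)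
Lemma approximable_add_point (A : {set P}) p :
  p \in A -> ~ on_three_lines f A p -> approximable (A :\ p) -> approximable A.
Proof.
move=> pA no3 [g [gf gcol]].
have pair_in a a' : collinear_pair f A p a a' ->
    [/\ a \in A :\ p, a' \in A :\ p, a != a', p != a & p != a'] /\
    collin f p a a'.
  case/and5P=> aA a'A pa pa' /andP[aa' paa'].
  by rewrite !inE aA a'A (eq_sym a) pa (eq_sym a') pa'.
have along q a a' s t : collinear_pair f A p a a' -> collinear_pair f A p s t ->
    collin f p a s ->
    (\forall n \near \oo, wedge (g n a) (g n a') (q n) == 0) ->
    \forall n \near \oo, wedge (q n) (g n s) (g n t) == 0.
  move=> /pair_in[[aA a'A aa' pa pa'] paa'].
  move=> /pair_in[[sA tA st ps pt] pst] pas qa.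
  have pat : collin f p a t.
    by apply: (collin_trans f_inj ps) => //; rewrite ?collinxyx // collin_swapr.
  have aa's : collin f a a' s.
    by apply: (collin_trans f_inj pa) => //; exact: collinxyy.
  have aa't : collin f a a' t.
    by apply: (collin_trans f_inj pa) => //; exact: collinxyy.
  have g_aa' : \forall n \near \oo, g n a != g n a'.
    by apply: tends_to_neq (gf _ aA) (gf _ a'A) _; rewrite (inj_eq f_inj).
  have g_s := gcol _ _ _ aA a'A sA aa's.
  have g_t := gcol _ _ _ aA a'A tA aa't.
  near=> n; apply/eqP; apply: (@wedge0_trans _ (g n a) (g n a')).
  - by near: n.
  - by apply/eqP; near: n.
  - by apply/eqP; near: n.
  - by apply/eqP; near: n.
have addp := approximable_extend pA gf gcol.
case: (at_most_two_lines no3) =>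
  [no1 | [a [a' [pa on_a]]] | [a [a' [b [b' [pa pb ab on_ab]]]]]].
- have [q1 q1E] := rat_sequence (f p).1; have [q2 q2E] := rat_sequence (f p).2.
  apply: (addp (fun n => (q1 n, q2 n))); first by split.
  by move=> s t; rewrite (negPf (no1 s t)).
- have [[aA a'A aa' pna pna'] paa'] := pair_in _ _ pa.
  have fa : f a != f a' by rewrite (inj_eq f_inj).
  have : wedge (f a) (f a') (f p) = 0 by apply/eqP; rewrite -wedge_rot.
  case/(wedge0_interp fa) => t pE; have [r rE] := rat_sequence t.
  apply: (addp (fun n => interp (r n) (g n a) (g n a'))).
    by rewrite pE; apply: tends_to_interp => //; apply: gf.
  move=> s s' pss'; apply: (along _ a a') => //; first exact: on_a pss'.
  by apply: nearW => n; rewrite wedge_interp.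
have [[aA a'A aa' pna pna'] paa'] := pair_in _ _ pa.
have [[bA b'A bb' pnb pnb'] pbb'] := pair_in _ _ pb.
have fa : f a != f a' by rewrite (inj_eq f_inj).
have fap : wedge (f a) (f a') (f p) = 0 by apply/eqP; rewrite -wedge_rot.
have fbp : wedge (f b) (f b') (f p) = 0 by apply/eqP; rewrite -wedge_rot.
have fba : wedge (f b) (f b') (f a) != 0.
  apply: contra ab => bb'a; rewrite collin_swapr.
  apply: (collin_trans f_inj bb') => //.
  - by rewrite -collin_rot.
  - exact: collinxyx.
have [D pE] := crossing_unique fa fba fap fbp.
pose q n := crossing (g n a) (g n a') (g n b) (g n b').
apply: (addp q).
  by rewrite pE; apply: tends_to_crossing => //; apply: gf.
move=> s t pst; case/orP: (on_ab s t pst) => ps.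
  apply: (along _ a a') => //; apply: nearW => n.
  by rewrite wedge_interp.
apply: (along _ b b') => //.
have c := tends_to_wedge (gf _ bA) (gf _ b'A) (gf _ aA).
have c' := tends_to_wedge (gf _ bA) (gf _ b'A) (gf _ a'A).
have D0 : wedge (f b) (f b') (f a) - wedge (f b) (f b') (f a') != 0.
  by rewrite subr_eq0.
have : \forall n \near \oo, ratr (wedge (g n b) (g n b') (g n a)) -
    ratr (wedge (g n b) (g n b') (g n a')) != 0 :> R.
  exact: (cvgr_neq0 _ (cvgB c c')).
apply: filterS => n Dn; rewrite wedge_crossing //.
by apply: contra Dn => /eqP ->; rewrite subrr.
Unshelve. all: by end_near.
Qed.

(** Points on at most two rich lines are removed one by one; [pencils_empty]
ensures that there is one as long as points are left. *)
Lemma small_approximable (A : {set P}) : (#|A| <= 8)%N -> approximable A.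
Proof.
have [n leAn] := ubnP #|A|; elim: n => // n IHn in A leAn *; move=> A8.
have [allp | /existsNP[p /not_implyP[pA no3]]] :=
  pselect {in A, forall p, on_three_lines f A p}.
  by rewrite (pencils_empty f_inj A8 allp); apply: approximable_set0.
have ltA : (#|A :\ p| < #|A|)%N by rewrite [in X in (_ < X)%N](cardsD1 p A) pA.
apply: approximable_add_point no3 _ => //; apply: IHn.
  exact: leq_trans ltA leAn.
exact: leq_trans (ltnW ltA) A8.
Qed.

Lemma approximable_realization : approximable [set: P] ->
  exists g : P -> rat * rat,
    injective g /\ forall x y z, collin g x y z = collin f x y z.
Proof.
move=> [g [gf gcol]].
have fT p : p \in [set: P] by rewrite inE.
have near_inj : \forall n \near \oo, forall xy : P * P,
    xy.1 != xy.2 -> g n xy.1 != g n xy.2.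
  apply: filter_forall => -[x y] /=.
  have [-> | xy] := eqVneq x y; first by apply: nearW.
  have := tends_to_neq (gf _ (fT x)) (gf _ (fT y)).
  by rewrite (inj_eq f_inj) => /(_ xy); apply: filterS.
have near_col : \forall n \near \oo, forall xyz : P * P * P,
    collin (g n) xyz.1.1 xyz.1.2 xyz.2 = collin f xyz.1.1 xyz.1.2 xyz.2.
  apply: filter_forall => -[[x y] z] /=.
  have [xyz | xyz] := boolP (collin f x y z).
    exact: gcol.
  have c := tends_to_wedge (gf _ (fT x)) (gf _ (fT y)) (gf _ (fT z)).
  apply: filterS (cvgr_neq0 _ c xyz) => n wn.
  by apply/negbTE; apply: contra wn => /eqP ->; rewrite rmorph0.
have [N [ginj gcolN]] := filter_ex (filterI near_inj near_col).
exists (g N); split=> [x y e | x y z]; last exact: (gcolN (x, y, z)).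
by apply: contra_eq e => xy; apply: (ginj (x, y)).
Qed.

End Approximation.

Lemma collinearP (R : realType) (P : finType) (f : P -> R * R) (s : {set P})
    x y z :
  injective f -> x != y -> s =i [:: x; y; z] ->
  collinear f s <-> collin f x y z.
Proof.
move=> f_inj xy sE; have fxy : f x != f y by rewrite (inj_eq f_inj).
split=> [[a [b [c [ab abc]]]] | xyz].
  have on w : w \in [:: x; y; z] -> a * (f w).1 + b * (f w).2 = c.
    by rewrite -sE => /abc.
  have ex := on x; have ey := on y; have ez := on z.
  rewrite !inE !eqxx ?orbT in ex ey ez.
  move: (ex isT) (ey isT) (ez isT) ab => {ex ey ez}ex ey ez ab.
  have dy : a * ((f y).1 - (f x).1) + b * ((f y).2 - (f x).2) = 0 by lra.
  have dz : a * ((f z).1 - (f x).1) + b * ((f z).2 - (f x).2) = 0 by lra.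
  have a0 : a * wedge (f x) (f y) (f z) = 0.
    transitivity ((a * ((f y).1 - (f x).1) + b * ((f y).2 - (f x).2)) *
        ((f z).2 - (f x).2) - ((f y).2 - (f x).2) *
        (a * ((f z).1 - (f x).1) + b * ((f z).2 - (f x).2))).
      by rewrite /wedge; ring.
    by rewrite dy dz mul0r mulr0 subr0.
  have b0 : b * wedge (f x) (f y) (f z) = 0.
    transitivity (((f y).1 - (f x).1) *
        (a * ((f z).1 - (f x).1) + b * ((f z).2 - (f x).2)) -
        (a * ((f y).1 - (f x).1) + b * ((f y).2 - (f x).2)) *
        ((f z).1 - (f x).1)).
      by rewrite /wedge; ring.
    by rewrite dy dz mul0r mulr0 subr0.
  apply: contraR ab; rewrite /collin => w0; rewrite xpair_eqE.
  move/eqP: a0; rewrite mulf_eq0 (negPf w0) orbF => ->.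
  by move/eqP: b0; rewrite mulf_eq0 (negPf w0) orbF => ->.
exists (- ((f y).2 - (f x).2)), ((f y).1 - (f x).1),
  (- ((f y).2 - (f x).2) * (f x).1 + ((f y).1 - (f x).1) * (f x).2); split.
  apply: contra fxy; rewrite xpair_eqE oppr_eq0 !subr_eq0.
  case/andP=> /eqP e2 /eqP e1.
  by rewrite [f x]surjective_pairing [f y]surjective_pairing e1 e2.
move=> w; rewrite sE !inE /on_line => /or3P[] /eqP ->; first by [].
  by ring.
by move/eqP: xyz; rewrite /wedge => e; lra.
Qed.

Theorem theorem2 (R : realType) (P : finType) (S : {set {set P}})
    (hP : (#|P| <= 8)%N) (hS : arrangement S) :
  (exists f : P -> R * R, realization S f) ->
  exists g : P -> R * R, realization S g /\ rational_coords g.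
Proof.
move=> [f [f_inj fS]].
have [|g [g_inj gf]] := approximable_realization f_inj.
  by apply: small_approximable; rewrite // cardsT.
have eg_inj : injective (embed R \o g).
  move=> x y [/fmorph_inj e1 /fmorph_inj e2]; apply: g_inj.
  by rewrite [g x]surjective_pairing [g y]surjective_pairing e1 e2.
exists (embed R \o g); split; last by move=> p; exists (g p).1, (g p).2.
split=> // s s3; rewrite -(fS s s3).
have /card_gt2P[x [y [z [[xs ys zs] [xy yz zx]]]]] : (2 < #|s|)%N by rewrite s3.
have sE : s =i [:: x; y; z].
  have us : uniq [:: x; y; z] by rewrite /= !inE negb_or xy yz eq_sym zx.
  move=> w; apply/idP/idP; last by rewrite !inE => /or3P[] /eqP ->.
  apply: (uniq_full us); last by rewrite s3.
  by move=> v; rewrite !inE => /or3P[] /eqP ->.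
rewrite (collinearP f_inj xy sE) (collinearP eg_inj xy sE) -gf.
by rewrite /collin wedge_embed fmorph_eq0.
Qed.
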